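(* Let $0\le r<1$, $d\in\mathbb{N}$. Then $$P(d,r,n)>1-\frac{n(n-1)}{2^{d}}.$$
   Context: $B_d=\{X\in\mathbb{R}^d:\ \|X\|\le 1\}$ is the $d$-dimensional Euclidean unit ball centered at the origin, and $rB_d$ is the $d$-dimensional ball of radius $r$ centered at the origin. $M_n=\{X_1,\ldots,X_n\}$ is the set of $n$ points chosen randomly, independently, according to the uniform distribution on the spherical layer $B_d\setminus rB_d$. A point $X\in\mathbb{R}^d$ is linearly separable from a set $M\subset\mathbb{R}^d$ if there exists $A_X\in\mathbb{R}^d$ such that $(A_X,X)>(A_X,Y)$ for all $Y\in M$, where $(\cdot,\cdot)$ is the standard inner product. A set $\{X_1,\ldots,X_n\}\subset\mathbb{R}^d$ is linearly separable if each point $X_i$ is linearly separable from all other points in the set. $P(d,r,n)$ denotes the probability that $M_n$ is linearly separable.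
   Formalization: The formal theorem assumes n ≥ 2; for n = 0 or n = 1 the set is always linearly separable, so P(d,r,n) = 1 and the strict inequality would read 1 > 1, which is false. *)

(* Defs.v *)
From HB Require Import structures.
From mathcomp Require Import all_boot all_order all_algebra.
From mathcomp Require Import all_classical all_reals all_analysis.

Set Implicit Arguments.
Unset Strict Implicit.
Unset Printing Implicit Defensive.
Import Order.TTheory GRing.Theory Num.Theory.
Local Open Scope classical_set_scope.
Local Open Scope ring_scope.

(* R^d is the type [d.-tuple R], which the library equips
   with the product sigma-algebra, i.e. the Borel sets of R^d. *)

Section Euclidean.
Context {R : realType} {d : nat}.
Implicit Types (x y a : d.-tuple R) (M : set (d.-tuple R)).

Definition dotp x y : R := \sum_(i < d) tnth x i * tnth y i.

Definition enorm x : R := Num.sqrt (dotp x x).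

Definition ball0 (r : R) : set (d.-tuple R) := [set x | enorm x <= r].

Definition layer (r : R) : set (d.-tuple R) := ball0 1 `\` ball0 r.

Definition separable_from x M : Prop :=
  exists a, forall y, M y -> dotp a x > dotp a y.

(* For a finite family of points, this is applied to its range: a repeated point
   counts once. *)
Definition linearly_separable M : Prop :=
  forall x, M x -> separable_from x (M `\ x).

End Euclidean.

Section Lebesgue.
Context {R : realType}.

Definition consp n (p : measurableTypeR R * n.-tuple R) : n.+1.-tuple R :=
  [tuple of p.1 :: p.2].

Lemma measurable_consp n : measurable_fun [set: measurableTypeR R * n.-tuple R] (@consp n).
Proof. exact: measurable_cons. Qed.

Definition unconsp n (t : n.+1.-tuple R) : measurableTypeR R * n.-tuple R :=
  (thead t, [tuple of behead t]).

Lemma measurable_unconsp n :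
  measurable_fun [set: n.+1.-tuple R] (@unconsp n).
Proof.
by apply: measurable_fun_pair; [exact: measurable_tnth|exact: measurable_behead].
Qed.

Lemma conspK n : cancel (@consp n) (@unconsp n).
Proof.
by case=> x t; rewrite /unconsp /consp theadE; congr pair; exact: val_inj.
Qed.

(* The library declares no sigma-finite instance on [m1 \x m2] that can be
   reused here, hence the direct construction of [lebesgue^1 (x) m], transported
   along [R * R^n ~ R^n.+1]. *)
Section cons_measure.
Variables (n : nat) (m : {sigma_finite_measure set (n.-tuple R) -> \bar R}).
Local Open Scope ereal_scope.

Definition cons_measure : set (n.+1.-tuple R) -> \bar R :=
  pushforward (@lebesgue_measure R \x m) (@consp n).

Let cons_measure0 : cons_measure set0 = 0.
Proof. by rewrite /cons_measure /pushforward preimage_set0 measure0. Qed.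

Let cons_measure_ge0 A : 0 <= cons_measure A.
Proof. by rewrite /cons_measure /pushforward measure_ge0. Qed.

Let cons_measure_semi_sigma_additive : semi_sigma_additive cons_measure.
Proof.
exact: (@measure_semi_sigma_additive _ _ _
  (measure_function_pushforward__canonical__measure_function_Measure
     (@lebesgue_measure R \x m) (@measurable_consp n))).
Qed.

HB.instance Definition _ := isMeasure.Build _ _ _ cons_measure
  cons_measure0 cons_measure_ge0 cons_measure_semi_sigma_additive.

Let cons_measure_sigma_finite : sigma_finite setT cons_measure.
Proof.
have /sigma_finiteP[F [FT ndF Foo]] := sigma_finiteT (@lebesgue_measure R).
have /sigma_finiteP[G [GT ndG Goo]] := sigma_finiteT m.
exists (fun k => @unconsp n @^-1` (F k `*` G k)).
  rewrite -preimage_bigcup (_ : \bigcup_k _ = setT) ?preimage_setT//.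
  apply/seteqP; split=> // -[x y] _.
  have [k _ Fkx] : (\bigcup_k F k) x by rewrite -FT.
  have [l _ Gly] : (\bigcup_k G k) y by rewrite -GT.
  exists (maxn k l) => //; split => /=.
    by move: x Fkx; exact/subsetPset/ndF/leq_maxl.
  by move: y Gly; exact/subsetPset/ndG/leq_maxr.
move=> k; have [mF Fk] := Foo k; have [mG Gk] := Goo k; split.
  rewrite -[X in measurable X]setTI; apply: measurable_unconsp => //.
  exact: measurableX.
rewrite /cons_measure /pushforward -comp_preimage.
rewrite (_ : _ \o _ = id); last by apply/funext => p /=; exact: conspK.
by rewrite preimage_id product_measure1E// lte_mul_pinfty// ge0_fin_numE.
Qed.

HB.instance Definition _ := Measure_isSigmaFinite.Build _ _ _ cons_measure
  cons_measure_sigma_finite.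

End cons_measure.

(* d-dimensional Lebesgue measure, as the d-fold product of [lebesgue_measure];
   by [lebesgue_tuple_box] it gives boxes their usual volume, which determines
   it uniquely. *)
Fixpoint lebesgue_tuple (d : nat) :
    {sigma_finite_measure set (d.-tuple R) -> \bar R} :=
  match d with
  | 0 => \d_([tuple] : 0.-tuple R)
  | d'.+1 => cons_measure (lebesgue_tuple d')
  end.

Lemma lebesgue_tuple_box d (A : 'I_d -> set R) :
  (forall i, measurable (A i)) ->
  lebesgue_tuple d [set x | forall i, A i (tnth x i)] =
  (\prod_(i < d) lebesgue_measure (A i))%E.
Proof.
elim: d A => [|d IHd] A mA.
  by rewrite big_ord0 /= diracE mem_set// => -[].
rewrite big_ord_recl -IHd => [|i]; last exact: mA.
rewrite -product_measure1E//=.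
  rewrite /cons_measure /pushforward; congr (_ \x _)%E.
  apply/seteqP; split=> -[x t] /=.
    move=> h; split=> [|i]; first by have := h ord0.
    by have := h (lift ord0 i); rewrite /consp tnthS.
  move=> [h0 h1] i; rewrite /consp.
  by case: (unliftP ord0 i) => [j|] ->; [rewrite tnthS; exact: h1|exact: h0].
  exact: mA.
rewrite (_ : [set _ | _] = \bigcap_i
  ((fun x : d.-tuple R => tnth x i) @^-1` A (lift ord0 i))); last first.
  by apply/seteqP; split=> x /= h i; [move=> _|]; apply: h.
apply: fin_bigcap_measurable => // i _.
by rewrite -[X in measurable X]setTI; apply: measurable_tnth => //; exact: mA.
Qed.

End Lebesgue.

Section Random.
Context {disp : measure_display} {Omega : measurableType disp} {R : realType}.
Variable P : probability Omega R.

(* The quotient is taken in [\bar R]; it is the intended one as soon as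
   [0 < lebesgue_tuple d L < +oo], as for [L = layer r], [0 <= r < 1], [0 < d]. *)
Definition uniform_on {d : nat} (X : {RV P >-> d.-tuple R})
    (L : set (d.-tuple R)) : Prop :=
  forall A : set (d.-tuple R), measurable A ->
    distribution P X A = (lebesgue_tuple d (A `&` L) / lebesgue_tuple d L)%E.

Definition independent_RVs {disp' : measure_display} {T : measurableType disp'}
    {n : nat} (X : 'I_n -> {RV P >-> T}) : Prop :=
  forall (J : {set 'I_n}) (B : 'I_n -> set T),
    (forall i, measurable (B i)) ->
    P (\bigcap_(i in [set` J]) (X i @^-1` B i)) =
    (\prod_(i in J) P (X i @^-1` B i))%E.

End Random.

(* Main.v *)
(**
If a point x of the sample is not separated from the others by the direction x
itself, then some other sample point y satisfies (x, y) >= (x, x), i.e. x lies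
in the ball S_y with diameter [0, y]. Let B_s be the ball of radius s and L the
layer. For y in L, put z = (r / |y|) y: S_z is contained in both S_y and B_r, so
  vol (S_y & L) <= vol S_y - vol S_z
                 = 2^-d (vol B_|y| - vol B_r) = 2^-d vol (B_|y| & L).
Integrating over y gives P (x in S_y) <= 2^-d P (|x| <= |y|) < 2^-d, and the
union bound over the n (n - 1) ordered pairs concludes.
*)
Require Import Defs.
From mathcomp Require Import all_boot all_order all_algebra.
From mathcomp Require Import all_classical all_reals all_analysis.
From mathcomp Require Import measurable_realfun.
From mathcomp Require Import ring lra.
Import Order.TTheory GRing.Theory Num.Theory.
Local Open Scope classical_set_scope.
Local Open Scope ring_scope.

(** * Behaviour of Lebesgue measure under the maps [x |-> a x + c] *)

Section Affine.
Context {R : realType}.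

(** As a function of [A], the left side is a scaled pushforward measure. It gives half-open
    intervals their length, which characterises Lebesgue measure. *)
Lemma lebesgue_measure_affine (a b : R) (A : set R) : 0 < a ->
  measurable A ->
  (a%:E * lebesgue_measure ((fun x : R => (a * x + b)%R) @^-1` A))%E =
  lebesgue_measure A.
Proof.
move=> a0 mA.
have mf : measurable_fun [set: measurableTypeR R]
    (fun x : R => a * x + b : measurableTypeR R).
  by apply: measurable_funD => //; exact: mulrl_measurable.
have ha : 0 <= a by exact: ltW.
have := @lebesgue_measure_unique R (mscale (NngNum ha)
  (measure_function_pushforward__canonical__measure_function_Measure
     (@lebesgue_measure R) mf)).
move=> h; rewrite (h _ A)// => {h} _ [[u v] _ <-] /=.
rewrite /mscale /= /pushforward.
rewrite (_ : _ @^-1` _ = `]((u - b) / a), ((v - b) / a)]%classic); last first.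
  apply/seteqP; split => x /=; rewrite !in_itv/= ltr_pdivrMr//
    ler_pdivlMr// ltrBlDr lerBrDr [x * a]mulrC//.
rewrite !lebesgue_measure_itv /= !lte_fin ltr_pM2r ?invr_gt0// ltrD2r.
case: ifPn => _; last by rewrite mule0.
rewrite -!EFinB -EFinM; congr (_%:E).
by rewrite -mulrBl opprD addrACA opprK addNr addr0 mulrCA divff ?gt_eqF// mulr1.
Qed.

Definition affine_tuple {d : nat} (a : R) (c x : d.-tuple R) : d.-tuple R :=
  [tuple a * tnth x i + tnth c i | i < d].

Lemma measurable_affine_tuple {d} a (c : d.-tuple R) :
  measurable_fun [set: d.-tuple R] (affine_tuple a c).
Proof.
apply/measurable_fun_tnthP => i.
rewrite (_ : _ \o _ = fun x => a * tnth x i + tnth c i); last first.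
  by apply/funext => x /=; rewrite tnth_mktuple.
apply: measurable_funD => //; apply: measurable_funM => //.
exact: measurable_tnth.
Qed.

Lemma affine_tuple_consp {d} a (c : d.+1.-tuple R) p :
  affine_tuple a c (consp p) =
  consp (a * p.1 + thead c, affine_tuple a [tuple of behead c] p.2).
Proof.
apply: eq_from_tnth => i; rewrite tnth_mktuple /consp.
case: (unliftP ord0 i) => [j|] -> /=; last by rewrite !tnth0.
rewrite !tnthS tnth_mktuple; congr (_ + _).
by rewrite [c in LHS]tuple_eta tnthS.
Qed.

(** Induction on the dimension: the scaled pushforward under the affine map agrees with the product
    measure on rectangles, by the one-dimensional case on one side and the induction hypothesis on
    the other. *)
Lemma lebesgue_tuple_affine {d} (a : R) (c : d.-tuple R) (A : set (d.-tuple R)) :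
  0 < a -> measurable A ->
  ((a ^+ d)%:E * lebesgue_tuple d (affine_tuple a c @^-1` A))%E =
  lebesgue_tuple d A.
Proof.
move=> a0; elim: d c A => [|d IH] c A mA.
  (* In dimension 0 the measure is the Dirac mass at the only tuple, which the map fixes. *)
  rewrite expr0 mul1e /= !diracE; congr ((_ : bool)%:R%:E).
  by apply/idP/idP; rewrite !inE /= (tuple0 (affine_tuple _ _ _)).
have ha : 0 <= a ^+ d.+1 by rewrite exprn_ge0// ltW.
pose c' : d.-tuple R := [tuple of behead c].
(* [g] is the affine map with the first coordinate split off. *)
pose g (p : measurableTypeR R * d.-tuple R) :=
  ((a * p.1 + thead c : measurableTypeR R), affine_tuple a c' p.2).
have mg : measurable_fun setT g.
  apply: measurable_fun_pair.
    apply: measurable_funD => //.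
    apply: (@measurableT_comp _ _ _ _ _ _ (fun x : R => a * x)) => //.
    exact: mulrl_measurable.
  apply: measurableT_comp => //.
  exact: measurable_affine_tuple.
pose m := mscale (NngNum ha)
  (measure_function_pushforward__canonical__measure_function_Measure
     (@lebesgue_measure R \x lebesgue_tuple d)%E mg).
have mcA : measurable (@consp R d @^-1` A).
  by rewrite -[X in measurable X]setTI; apply: measurable_consp.
transitivity (m (@consp R d @^-1` A)).
  rewrite /m /mscale /=; congr (_ * _)%E.
  rewrite /cons_measure /pushforward; congr (_ _).
  by apply/seteqP; split => p /=; rewrite affine_tuple_consp.
apply/esym.
apply: (@product_measure_unique _ _ _ _ _ (@lebesgue_measure R)
  (lebesgue_tuple d) m) => // X Y mX mY.
transitivity ((a ^+ d.+1)%:E * (@lebesgue_measure R \x lebesgue_tuple d)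
  (((fun x : R => (a * x + thead c)%R) @^-1` X) `*` (affine_tuple a c' @^-1` Y)))%E.
  by [].
rewrite product_measure1E; last 2 first.
- rewrite -[X in measurable X]setTI.
  have : measurable_fun [set: measurableTypeR R]
      (fun x : R => a * x + thead c : measurableTypeR R).
    by apply: measurable_funD => //; exact: mulrl_measurable.
  exact.
- by rewrite -[X in measurable X]setTI; apply: measurable_affine_tuple.
rewrite exprS EFinM muleACA; congr (_ * _)%E; last exact: IH.
exact: lebesgue_measure_affine.
Qed.

End Affine.

(** * Inner products, centred balls and balls with diameter [[0, y]] *)

Section Balls.
Context {R : realType} {d : nat}.
Implicit Types (x y a c : d.-tuple R).

Lemma dotp_ge0 x : 0 <= dotp x x.
Proof. by apply: sumr_ge0 => i _; rewrite -expr2 sqr_ge0. Qed.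

Lemma dotpC x y : dotp x y = dotp y x.
Proof. by apply: eq_bigr => i _; rewrite mulrC. Qed.

Lemma dotp_affinel (k : R) c x y :
  dotp (affine_tuple k c x) y = k * dotp x y + dotp c y.
Proof.
rewrite /dotp mulr_sumr -big_split/=; apply: eq_bigr => i _.
by rewrite tnth_mktuple mulrDl mulrA.
Qed.

Lemma dotp_affine (k : R) c x :
  dotp (affine_tuple k c x) (affine_tuple k c x) =
  k ^+ 2 * dotp x x + 2 * k * dotp x c + dotp c c.
Proof.
rewrite dotp_affinel [dotp x _]dotpC [dotp c _]dotpC !dotp_affinel (dotpC c x).
by ring.
Qed.

Lemma enorm_ge0 x : 0 <= enorm x.
Proof. exact: sqrtr_ge0. Qed.

Lemma sqr_enorm x : enorm x ^+ 2 = dotp x x.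
Proof. by rewrite sqr_sqrtr// dotp_ge0. Qed.

Lemma enorm_leE x (s : R) : 0 <= s -> (enorm x <= s) = (dotp x x <= s ^+ 2).
Proof. by move=> s0; rewrite -sqr_enorm ler_sqr// nnegrE enorm_ge0. Qed.

Lemma measurable_dotp disp (T : measurableType disp) (f g : T -> d.-tuple R) :
  measurable_fun setT f -> measurable_fun setT g ->
  measurable_fun setT (fun t => dotp (f t) (g t)).
Proof.
move=> mf mg; apply: measurable_sum => i.
apply: measurable_funM.
  exact: (measurableT_comp (measurable_tnth i) mf).
exact: (measurableT_comp (measurable_tnth i) mg).
Qed.

Lemma measurable_enorm : measurable_fun setT (@enorm R d).
Proof.
apply: measurableT_comp; last exact: measurable_dotp.
by apply: continuous_measurable_fun; exact: sqrt_continuous.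
Qed.

Lemma measurable_ball0 (s : R) : measurable (@Defs.ball0 R d s).
Proof.
rewrite -[X in measurable X]setTI; apply: measurable_fun_le => //.
exact: measurable_enorm.
Qed.

Lemma measurable_layer (s : R) : measurable (@layer R d s).
Proof. by apply: measurableD; exact: measurable_ball0. Qed.

(* The closed ball with diameter [0, y]: |2 x - y| <= |y|. *)
Definition diam_ball y : set (d.-tuple R) := [set x | dotp x x <= dotp x y].

Definition zero_tuple : d.-tuple R := [tuple 0 | _ < d].

Lemma dotp0l x : dotp zero_tuple x = 0.
Proof. by rewrite /dotp big1// => i _; rewrite tnth_mktuple mul0r. Qed.

Definition scale_tuple (k : R) x := affine_tuple k zero_tuple x.

Lemma dotp_scalel k x y : dotp (scale_tuple k x) y = k * dotp x y.
Proof. by rewrite dotp_affinel dotp0l addr0. Qed.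

Lemma dotp_scaler k x y : dotp x (scale_tuple k y) = k * dotp x y.
Proof. by rewrite dotpC dotp_scalel dotpC. Qed.

Lemma enorm_scale k x : 0 <= k -> enorm (scale_tuple k x) = k * enorm x.
Proof.
move=> k0; rewrite /enorm dotp_scalel dotp_scaler mulrA -expr2.
by rewrite sqrtrM ?sqr_ge0// sqrtr_sqr ger0_norm.
Qed.

(** [|2 x - y|^2 = 4 (x, x) - 4 (x, y) + (y, y)] is at most [(y, y)] exactly when
    [(x, x) <= (x, y)]. In this form the scaling formula yields the volume. *)
Lemma diam_ballE y :
  diam_ball y = affine_tuple 2 (scale_tuple (-1) y) @^-1` Defs.ball0 (enorm y).
Proof.
apply/seteqP; split => x; rewrite /diam_ball /Defs.ball0 /=;
  rewrite enorm_leE ?enorm_ge0// sqr_enorm dotp_affine !dotp_scaler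
    dotp_scalel; lra.
Qed.

Lemma measurable_diam_ball y : measurable (diam_ball y).
Proof.
rewrite -[X in measurable X]setTI; apply: measurable_fun_le => //;
  exact: measurable_dotp.
Qed.

Lemma diam_ball_sub_ball0 y : diam_ball y `<=` Defs.ball0 (enorm y).
Proof.
move=> x /=; rewrite /diam_ball /Defs.ball0 /= enorm_leE ?enorm_ge0// sqr_enorm => h.
(* Expanding [|y - x|^2 >= 0] bounds [2 (x, y)] by [(x, x) + (y, y)]. *)
have := dotp_ge0 (affine_tuple (-1) y x).
by rewrite dotp_affine; lra.
Qed.

Lemma dotp_le0 x y : dotp x x <= 0 -> dotp x y = 0.
Proof.
move=> x0; have /eqP : dotp x x = 0 by apply/le_anti; rewrite x0 dotp_ge0.
rewrite /dotp psumr_eq0 => [/allP h|i _]; last by rewrite -expr2 sqr_ge0.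
apply: big1 => i _; have := h i (mem_index_enum _).
by rewrite /= mulf_eq0 orbb => /eqP ->; rewrite mul0r.
Qed.

(** If [(x, y) >= 0], then [k (x, y) <= (x, y)]. A negative [(x, y)] is impossible: it would give
    [(x, x) <= k (x, y) <= 0], so [x = 0] and [(x, y) = 0]. *)
Lemma diam_ball_scale_sub y k : 0 <= k <= 1 ->
  diam_ball (scale_tuple k y) `<=` diam_ball y.
Proof.
move=> /andP[k0 k1] x; rewrite /diam_ball/= dotp_scaler => h.
have [xy|xy] := leP 0 (dotp x y).
  by apply: le_trans h _; rewrite ler_piMl.
have x0 : dotp x x <= 0 by apply: le_trans h _; rewrite mulr_ge0_le0// ltW.
by rewrite (dotp_le0 _ _ x0) ltxx in xy.
Qed.

Lemma lebesgue_ball0_lty (s : R) : (lebesgue_tuple d (Defs.ball0 s) < +oo)%E.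
Proof.
(* The ball lies in this cube, whose volume is a finite product; the absolute value covers every
   sign of [s]. *)
pose Q := [set x : d.-tuple R | forall i, `[- `|s|, `|s|]%classic (tnth x i)].
have QE := @lebesgue_tuple_box R d
  (fun=> `[- `|s|, `|s|]%classic) (fun=> measurable_itv _).
apply: (@le_lt_trans _ _ (lebesgue_tuple d Q)); last first.
  rewrite QE.
  under eq_bigr do rewrite lebesgue_measure_itv/=.
  rewrite (_ : (\prod_(i < d) _)%E =
    (\prod_(i < d) (if (- `|s| < `|s|) then (`|s| - - `|s|) else 0))%:E).
    exact: ltry.
  rewrite -prodEFin; apply: eq_bigr => i _; rewrite lte_fin -EFinB; by case: ifP.
apply: le_measure; rewrite ?inE; first exact: measurable_ball0.
  rewrite (_ : Q = \bigcap_i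
    ((fun x : d.-tuple R => tnth x i) @^-1` `[- `|s|, `|s|]%classic)); last first.
    by apply/seteqP; split=> x /= h i; [move=> _|]; apply: h.
  apply: fin_bigcap_measurable => // i _.
  by rewrite -[X in measurable X]setTI; apply: measurable_tnth => //;
    exact: measurable_itv.
move=> x /= xs i; rewrite /= in_itv/= -ler_norml.
have s0 : 0 <= s by exact: le_trans (enorm_ge0 x) xs.
rewrite (ger0_norm s0) -ler_sqr ?nnegrE// real_normK ?num_real//.
move: xs; rewrite /Defs.ball0 /= enorm_leE//; apply: le_trans.
rewrite /dotp (bigD1 i)//= -expr2 lerDl.
by apply: sumr_ge0 => j _; rewrite -expr2 sqr_ge0.
Qed.

Lemma lebesgue_diam_ball y :
  ((2 ^+ d)%:E * lebesgue_tuple d (diam_ball y))%E =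
  lebesgue_tuple d (Defs.ball0 (enorm y)).
Proof. by rewrite diam_ballE lebesgue_tuple_affine//; exact: measurable_ball0. Qed.

Lemma lebesgue_ball0 (s : R) : 0 < s ->
  lebesgue_tuple d (Defs.ball0 s) = ((s ^+ d)%:E * lebesgue_tuple d (Defs.ball0 1))%E.
Proof.
move=> s0; rewrite -(lebesgue_tuple_affine s zero_tuple)//; last exact: measurable_ball0.
congr (_ * lebesgue_tuple d _)%E; apply/seteqP; split => x; rewrite /Defs.ball0/=;
  by rewrite (enorm_scale _ _ (ltW s0)) ger_pMr.
Qed.

End Balls.

(** * Volume estimates inside the spherical layer *)

Section Layer.
Context {R : realType} {d : nat}.
Implicit Types (r s : R) (y : d.-tuple R).

Lemma diam_ball_layer_le r y : 0 <= r -> layer r y ->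
  ((2 ^+ d)%:E * lebesgue_tuple d (diam_ball y `&` layer r) <=
   lebesgue_tuple d (Defs.ball0 (enorm y) `&` layer r))%E.
Proof.
move=> r0 [/= y1]; rewrite /Defs.ball0/= => /negP; rewrite -ltNge => ry.
have y0 : 0 < enorm y by exact: le_lt_trans ry.
(* [z] is the point of the segment [[0, y]] of norm [r]. *)
pose k := r / enorm y; pose z := scale_tuple k y.
have k01 : 0 <= k <= 1 by rewrite ler_pdivrMr// mul1r (ltW ry) divr_ge0// ltW.
have zr : enorm z = r by rewrite enorm_scale ?(andP k01).1// divfK// gt_eqF.
have Brfin : lebesgue_tuple d (Defs.ball0 r) \is a fin_num.
  by rewrite ge0_fin_numE ?measure_ge0// lebesgue_ball0_lty.
have mS y' : measurable (diam_ball y') by exact: (@measurable_diam_ball R d).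
have mB s : measurable (@Defs.ball0 R d s) by exact: measurable_ball0.
have mL : measurable (@layer R d r) by exact: measurable_layer.
(* Adding the finite volume of [B_r] to both sides avoids subtraction in the extended reals. *)
rewrite -(leeD2rE _ _ Brfin).
have ABr : (lebesgue_tuple d (Defs.ball0 (enorm y)) <=
    lebesgue_tuple d (Defs.ball0 (enorm y) `&` layer r) +
    lebesgue_tuple d (Defs.ball0 r))%E.
  rewrite -measureU//; last 2 first.
  - exact: measurableI.
  - by apply/seteqP; split => // x [[_ [_ h]] /h].
  apply: le_measure; rewrite ?inE//.
    by apply: measurableU => //; exact: measurableI.
  move=> x xy; have [xr|xr] := pselect (Defs.ball0 r x); [by right|left].
  by split => //; split => //; apply: le_trans xy y1.
apply: le_trans ABr.
(* As [|z| = r], the volumes of [B_r] and [B_|y|] are [2^d] times those of [S_z] and [S_y]. It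
   remains to fit the disjoint sets [S_y & L] and [S_z] into [S_y]. *)
rewrite -{2}zr -!lebesgue_diam_ball -ge0_muleDr ?measure_ge0//.
apply: lee_wpmul2l; first by rewrite lee_fin exprn_ge0.
rewrite -measureU//; last 2 first.
- exact: measurableI.
- apply/seteqP; split => // x [[_ [_ h]] /diam_ball_sub_ball0].
  by rewrite zr => /h.
apply: le_measure; rewrite ?inE//.
  by apply: measurableU => //; exact: measurableI.
by move=> x [[]|]//; exact: diam_ball_scale_sub.
Qed.

Lemma lebesgue_ball0D_gt0 (a b : R) : (0 < d)%N -> 0 <= a -> a < b ->
  (0 < lebesgue_tuple d (@Defs.ball0 R d 1))%E ->
  (0 < lebesgue_tuple d (Defs.ball0 b `\` Defs.ball0 a))%E.
Proof.
(* The scaling formula for balls asks for a positive radius, and [a] may be 0; the midpoint [c] is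
   positive. *)
move=> d0 a0 ab V0; pose c := (a + b) / 2.
have ac : a < c by rewrite /c; lra.
have cb : c < b by rewrite /c; lra.
have c0 : 0 < c by lra.
have b0 : 0 < b by lra.
have mB s : measurable (@Defs.ball0 R d s) by exact: measurable_ball0.
apply: (@lt_le_trans _ _ (lebesgue_tuple d (Defs.ball0 b `\` Defs.ball0 c))); last first.
  apply: le_measure; rewrite ?inE; [exact: measurableD..|].
  move=> x [xb xc]; split => // xa; apply: xc.
  by apply: le_trans (ltW ac).
have ? : Defs.ball0 c `<=` (@Defs.ball0 R d b).
  by move=> x xc; apply: le_trans (ltW cb).
rewrite measureD// ?lebesgue_ball0_lty// setIidr//.
rewrite [X in (X - _)%E](lebesgue_ball0 b)// [X in (_ - X)%E](lebesgue_ball0 c)//.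
have := lebesgue_ball0_lty (1 : R) (d := d).
case: (lebesgue_tuple d _) V0 => // v; rewrite lte_fin => v0 _.
rewrite -!EFinM -EFinB lte_fin -mulrBl mulr_gt0// subr_gt0.
by rewrite ltrXn2r ?nnegrE ?ltW// -lt0n.
Qed.

End Layer.

(** * Independent pairs and their joint law *)

Section Pair.
Context {disp : measure_display} {Omega : measurableType disp} {R : realType}.
Context {P : probability Omega R} {dT : measure_display} {T : measurableType dT}.

Definition independent_pair (X Y : {RV P >-> T}) :=
  forall A B, measurable A -> measurable B ->
    P (X @^-1` A `&` Y @^-1` B) = (P (X @^-1` A) * P (Y @^-1` B))%E.

Lemma independent_RVs_pair n (X : 'I_n -> {RV P >-> T}) i j :
  independent_RVs X -> i != j -> independent_pair (X i) (X j).
Proof.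
move=> hX ij A B mA mB.
(* Only the sets at [i] and [j] enter the product, so [B] serves at every index other than [i]. *)
have := hX [set i; j]%SET (fun k => if k == i then A else B).
rewrite big_setU1 ?inE//= big_set1 eqxx eq_sym (negbTE ij) => <-; last first.
  by move=> k; case: ifP.
congr (P _); apply/seteqP; split => [w [Aw Bw] k|w h].
  rewrite /= !inE => /orP[] /eqP ->; rewrite ?eqxx// eq_sym (negbTE ij)//.
split; first by have := h i; rewrite /= !inE eqxx; apply.
by have := h j; rewrite /= !inE eqxx orbT eq_sym (negbTE ij); apply.
Qed.

(** Independence makes the joint law agree with the product of the marginals on rectangles, hence on
    all measurable sets; the product measure is the integral of the measures of sections. *)
Lemma independent_pair_law (X Y : {RV P >-> T}) (E : set (T * T)) :
  independent_pair X Y -> measurable E ->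
  P [set w | E (X w, Y w)] =
  (\int[distribution P X]_x distribution P Y (xsection E x))%E.
Proof.
move=> hXY mE.
have mXY : measurable_fun setT (fun w => (X w, Y w)).
  by apply: measurable_fun_pair; exact: measurable_funPT.
apply/esym; apply: (@product_measure_unique _ _ _ _ _ (distribution P X)
  (distribution P Y) (pushforward P (fun w => (X w, Y w)))) => // A B mA mB.
Qed.

End Pair.

(** * Two independent uniform points of the layer *)

Section UniformPair.
Context {disp : measure_display} {Omega : measurableType disp} {R : realType}.
Context {P : probability Omega R} {d : nat}.
Implicit Types X Y : {RV P >-> d.-tuple R}.

(** A null [L] would give the whole space probability 0 instead of 1. Thus the existence of a
    uniform variable supplies the positivity of the volumes below. *)
Lemma uniform_on_gt0 X L : uniform_on X L -> (0 < lebesgue_tuple d L)%E.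
Proof.
move=> hX; rewrite lt0e measure_ge0 andbT; apply/negP => /eqP L0.
have := hX setT measurableT.
rewrite probability_setT setTI L0 mul0e => /eqP.
by rewrite eqe oner_eq0.
Qed.

Section law.
Context {r : R} {X : {RV P >-> d.-tuple R}}.
Hypotheses (d0 : (0 < d)%N) (r0 : 0 <= r) (hX : uniform_on X (layer r)).

Let L0 : (0 < lebesgue_tuple d (layer r))%E.
Proof. exact: uniform_on_gt0 hX. Qed.

Let Lfin : lebesgue_tuple d (layer r) \is a fin_num.
Proof.
rewrite ge0_fin_numE ?measure_ge0//.
apply: le_lt_trans (lebesgue_ball0_lty 1); apply: le_measure; rewrite ?inE.
- exact: measurable_layer.
- exact: measurable_ball0.
- exact: subDsetl.
Qed.

Let V0 : (0 < lebesgue_tuple d (@Defs.ball0 R d 1))%E.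
Proof.
apply: lt_le_trans L0 _; apply: le_measure; rewrite ?inE.
- exact: measurable_layer.
- exact: measurable_ball0.
- exact: subDsetl.
Qed.

Lemma uniform_layer_diam_ball y : layer r y ->
  ((2 ^+ d)%:E * distribution P X (diam_ball y) <=
   distribution P X (Defs.ball0 (enorm y)))%E.
Proof.
move=> Ly; rewrite !hX; [|exact: measurable_ball0|exact: measurable_diam_ball].
rewrite muleA; apply: lee_wpmul2r; first by rewrite inve_ge0 ltW.
exact: diam_ball_layer_le.
Qed.

Lemma uniform_layer_gt0 A : measurable A ->
  (0 < lebesgue_tuple d (A `&` layer r))%E -> (0 < distribution P X A)%E.
Proof.
move=> mA A0; have /andP[_ Loo] : (lebesgue_tuple d (layer r) != -oo%E) &&
    (lebesgue_tuple d (layer r) != +oo%E) by rewrite -fin_numE.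
by rewrite hX// mule_gt0// inve_gt0// gt_eqF.
Qed.

(** With its counterpart for the complement, this shows that a radius strictly between [r] and 1
    splits the law into two parts of positive mass; the strict inequality in [prob_in_diam_ball]
    comes from there. *)
Lemma uniform_layer_ball0_gt0 s : r < s -> s <= 1 ->
  (0 < distribution P X (Defs.ball0 s))%E.
Proof.
move=> rs s1; apply: uniform_layer_gt0; first exact: measurable_ball0.
rewrite (_ : _ `&` _ = Defs.ball0 s `\` Defs.ball0 r).
  by apply: lebesgue_ball0D_gt0; rewrite ?V0.

apply/seteqP; split => x; first by move=> [? []].
by move=> [xs xr]; split => //; split => //; apply: le_trans s1.
Qed.

Lemma uniform_layer_ball0C_gt0 s : r <= s -> s < 1 ->
  (0 < distribution P X (~` Defs.ball0 s))%E.
Proof.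
move=> rs s1; apply: uniform_layer_gt0.
  by apply: measurableC; exact: measurable_ball0.
rewrite (_ : _ `&` _ = Defs.ball0 1 `\` Defs.ball0 s).
  by apply: lebesgue_ball0D_gt0 => //; exact: le_trans rs.
apply/seteqP; split => x; first by move=> [? []].
by move=> [x1 xs]; split => //; split => // xr; apply: xs; apply: le_trans rs.
Qed.

Lemma uniform_layerC : distribution P X (~` layer r) = 0%E.
Proof.
rewrite hX; last by apply: measurableC; exact: measurable_layer.
by rewrite setICl measure0 mul0e.
Qed.

End law.

Lemma prob_in_diam_ball (r : R) X Y : (0 < d)%N -> 0 <= r -> r < 1 ->
  uniform_on X (layer r) -> uniform_on Y (layer r) -> independent_pair Y X ->
  (P [set w | diam_ball (Y w) (X w)] < (2 ^- d)%:E)%E.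
Proof.
move=> d0 r0 r1 hX hY hYX.
pose E := [set p : d.-tuple R * d.-tuple R | diam_ball p.1 p.2].
pose F := [set p : d.-tuple R * d.-tuple R | enorm p.2 <= enorm p.1].
have mE : measurable E.
  rewrite -[X in measurable X]setTI; apply: measurable_fun_le => //;
  exact: measurable_dotp.
have mF : measurable F.
  rewrite -[X in measurable X]setTI; apply: measurable_fun_le => //;
  by apply: measurableT_comp => //; exact: measurable_enorm.
have EF : ((2 ^+ d)%:E * P [set w | E (Y w, X w)] <= P [set w | F (Y w, X w)])%E.
  rewrite !(independent_pair_law _ _ _ hYX)// -ge0_integralZl//; last first.
    exact: measurable_fun_xsection.
  (* The estimate on sections is known for [y] in the layer only, that is, almost everywhere for the
     law of [Y]. *)
  apply: ae_ge0_le_integral => //.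
  - by move=> y _; rewrite mule_ge0// lee_fin exprn_ge0.
  - by apply: emeasurable_funM => //; exact: measurable_fun_xsection.
  - exact: measurable_fun_xsection.
  exists (~` layer r); split.
  - by apply: measurableC; exact: measurable_layer.
  - exact: uniform_layerC hY.
  move=> y; apply: contra_not => /= Ly _.
  have := uniform_layer_diam_ball r0 hX y Ly.
  rewrite (_ : xsection E y = diam_ball y); last first.
    by apply/seteqP; split => x; rewrite /xsection/= inE.
  by rewrite (_ : xsection F y = Defs.ball0 (enorm y))//; apply/seteqP;
    split => x; rewrite /xsection/= inE.
pose s := (1 + r) / 2.
have rs : r < s by rewrite /s; lra.
have s1 : s < 1 by rewrite /s; lra.
(* On [G], [|Y| <= s < |X|]. By independence [G] has positive probability, and it is disjoint from
   the event [|X| <= |Y|], whose probability is therefore below 1. *)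
pose G := Y @^-1` Defs.ball0 s `&` X @^-1` (~` Defs.ball0 s).
have mB : measurable (@Defs.ball0 R d s) by exact: measurable_ball0.
have mG : measurable G.
  apply: measurableI; rewrite -[X in measurable X]setTI; apply: measurable_funPT => //.
  exact: measurableC.
have G0 : (0 < P G)%E.
  rewrite hYX//; last exact: measurableC.
  apply: mule_gt0.
    by apply: (uniform_layer_ball0_gt0 d0 r0 hY s rs); exact: ltW.
  exact: (uniform_layer_ball0C_gt0 d0 r0 hX s (ltW rs)).
have F1 : (P [set w | F (Y w, X w)] < 1)%E.
  apply: (@le_lt_trans _ _ (P (~` G))).
    apply: le_measure; rewrite ?inE; last 2 first.
    - exact: measurableC.
    - by move=> w /= XY [Ys Xs]; apply: Xs; exact: le_trans Ys.
    rewrite -[X in measurable X]setTI; apply: measurable_fun_le => //;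
    by apply: (measurableT_comp measurable_enorm); exact: measurable_funPT.
  rewrite probability_setC// lteBlDr ?lteDl//.
  by rewrite fin_num_measure.
have p0 : (0 < (2 ^+ d : R)%:E)%E by rewrite lte_fin exprn_gt0.
rewrite -(lte_pmul2l _ p0)//.
by rewrite -EFinM divff ?expf_neq0//; apply: le_lt_trans EF F1.
Qed.

End UniformPair.

(** * Separability criterion and measurability of the separability event *)

Section Separability.
Context {R : realType} {d n : nat}.
Implicit Types (x : 'I_n -> d.-tuple R) (a : d.-tuple R).

Lemma linearly_separable_diam_ball x :
  (forall i j, i != j -> ~ diam_ball (x j) (x i)) ->
  linearly_separable [set x i | i in [set: 'I_n]].
Proof.
move=> h _ [i _ <-]; exists (x i) => _ [[j _ <-] /= xji].
rewrite ltNge; apply/negP; apply: h.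
(* Distinct points have distinct indices, so the hypothesis on pairs applies. *)
by apply: contra_not_neq xji => ->.
Qed.

Lemma dotp_sub a x i j :
  dotp a (x i) - dotp a (x j) =
  \sum_(k < d) tnth a k * (tnth (x i) k - tnth (x j) k).
Proof.
by rewrite /dotp -sumrB; apply: eq_bigr => k _; rewrite mulrBr.
Qed.

(* Finitely many strict inequalities survive a small perturbation of [a]. *)
Lemma rat_separator (J : pred 'I_n) i x a :
  (forall j, J j -> dotp a (x j) < dotp a (x i)) ->
  exists q : d.-tuple rat, forall j, J j ->
    dotp (map_tuple ratr q) (x j) < dotp (map_tuple ratr q) (x i).
Proof.
(* The summand 1 makes [M j] positive and leaves a strict margin: moving each coordinate of [a] by
   less than [e] changes the gap by at most [e * (M j - 1)]. *)
move=> aJ; pose M j := 1 + \sum_(k < d) `|tnth (x i) k - tnth (x j) k|.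
have M0 j : 0 < M j by rewrite ltr_pwDl// sumr_ge0.
(* The initial value 1 keeps [e] positive when no index satisfies [J]. *)
pose e := \big[Num.min/1]_(j | J j) ((dotp a (x i) - dotp a (x j)) / M j).
have e0 : 0 < e.
  by apply: lt_bigmin => // j Jj; rewrite divr_gt0// subr_gt0 aJ.
have /choice[q hq] (k : 'I_d) : exists q : rat, `|ratr q - tnth a k| < e.
  have /rat_in_itvoo[q] : tnth a k - e < tnth a k + e by lra.
  by rewrite in_itv/= => /andP[? ?]; exists q; rewrite ltr_norml; lra.
exists [tuple q k | k < d] => j Jj; rewrite -subr_gt0.
have : e * M j <= dotp a (x i) - dotp a (x j).
  by rewrite -ler_pdivlMr//; apply: bigmin_le_cond.
rewrite !dotp_sub.
set S := \sum_(k < d) _ => eS.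
rewrite (_ : \sum_(k < d) _ = S +
   \sum_(k < d) (ratr (q k) - tnth a k) * (tnth (x i) k - tnth (x j) k)); last first.
  rewrite -big_split/=; apply: eq_bigr => k _.
  by rewrite tnth_map tnth_mktuple; ring.
have : `|\sum_(k < d) (ratr (q k) - tnth a k) * (tnth (x i) k - tnth (x j) k)|
    <= e * \sum_(k < d) `|tnth (x i) k - tnth (x j) k|.
  apply: le_trans (ler_norm_sum _ _ _) _; rewrite mulr_sumr ler_sum// => k _.
  by rewrite normrM ler_wpM2r// ltW.
rewrite ler_norml => /andP[h _].
have : e * M j = e + e * \sum_(k < d) `|tnth (x i) k - tnth (x j) k|.
  by rewrite mulrDr mulr1.
by lra.
Qed.

(** Rational directions suffice, so the existential over directions becomes a countable union. The
    alternative [x j = x i] accounts for repeated points. *)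
Lemma linearly_separable_rat x :
  linearly_separable [set x i | i in [set: 'I_n]] <->
  forall i, exists q : d.-tuple rat, forall j, x j = x i \/
    dotp (map_tuple ratr q) (x j) < dotp (map_tuple ratr q) (x i).
Proof.
split=> [h i|h _ [i _ <-]].
  have [|a ha] := h (x i); first by exists i.
  have [j|q hq] := @rat_separator (fun j => x j != x i) i x a.
    by move=> /eqP ji; apply: ha; split => //; exists j.
  by exists q => j; have [->|/hq] := eqVneq (x j) (x i); [left|right].
have [q hq] := h i; exists (map_tuple ratr q) => _ [[j _ <-] /= ji].
by have [/ji|] := hq j.
Qed.

Lemma measurable_linearly_separable disp (T : measurableType disp)
    (X : 'I_n -> T -> d.-tuple R) : (forall i, measurable_fun setT (X i)) ->
  measurable [set w | linearly_separable [set X i w | i in [set: 'I_n]]].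
Proof.
move=> mX.
(* Equality of two points is written as two inequalities per coordinate, each of which defines a
   measurable set. *)
rewrite (_ : [set w | _] = \bigcap_i \bigcup_(q : d.-tuple rat) \bigcap_j
  ((\bigcap_k ([set w | tnth (X j w) k <= tnth (X i w) k] `&`
              [set w | tnth (X i w) k <= tnth (X j w) k])) `|`
   [set w | dotp (map_tuple ratr q) (X j w) <
            dotp (map_tuple ratr q) (X i w)])); last first.
  apply/seteqP; split => w.
    move=> /= /(linearly_separable_rat (fun i => X i w)) h i _.
    have [q hq] := h i; exists q => // j _; have [/= ji|] := hq j; last by right.
    by left => k _; split; rewrite /= ji.
  move=> /= h; apply/(linearly_separable_rat (fun i => X i w)) => i.
  have [q _ hq] := h i I; exists q => j; have [/= hk|] := hq j I; last by right.
  left; apply: eq_from_tnth => k; apply/le_anti/andP.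
  exact: hk.
apply: fin_bigcap_measurable => // i _.
apply: countable_bigcupT_measurable => // q.
apply: fin_bigcap_measurable => // j _.
have mt l k : measurable_fun setT (fun w => tnth (X l w) k).
  exact: (measurableT_comp (measurable_tnth k) (mX l)).
apply: measurableU.
  apply: fin_bigcap_measurable => // k _.
  by apply: measurableI; rewrite -[X in measurable X]setTI; apply: measurable_fun_le.
rewrite (_ : [set w | _ < _] = ~` [set w |
  dotp (map_tuple ratr q) (X i w) <= dotp (map_tuple ratr q) (X j w)]).
  apply: measurableC; rewrite -[X in measurable X]setTI.
  by apply: measurable_fun_le => //;
  exact: measurable_dotp.
by apply/seteqP; split => w /=; rewrite ltNge => /negP.
Qed.

End Separability.

(** * Counting ordered pairs and the union bound *)

Lemma sum_offdiag {R : pzRingType} n (c : R) :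
  \sum_(p : 'I_n * 'I_n | p.1 != p.2) c = n%:R * (n%:R - 1) * c.
Proof.
rewrite -(pair_big_dep predT (fun i j : 'I_n => i != j) (fun _ _ => c))/=.
under eq_bigr => i _.
  under eq_bigl do rewrite eq_sym.
  rewrite sumr_const cardC1 card_ord.
  over.
(* At [n = 0] the truncated predecessor differs from the ring element [n - 1], but both products
   vanish. *)
rewrite sumr_const card_ord; case: n => [|n]; first by rewrite mulr0n !mul0r.
have -> : n.+1%:R - 1 = n%:R :> R by rewrite -natr1 addrK.
by rewrite -mulrA !mulr_natl.
Qed.

Theorem theorem2 (R : realType) (d n : nat) (r : R)
    (hd : (0 < d)%N) (hn : (2 <= n)%N) (hr0 : 0 <= r) (hr1 : r < 1)
    (disp : measure_display) (Omega : measurableType disp)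
    (P : probability Omega R) (X : 'I_n -> {RV P >-> d.-tuple R})
    (hunif : forall i, uniform_on (X i) (layer r))
    (hindep : independent_RVs X) :
  (P [set w | linearly_separable [set X i w | i in [set: 'I_n]]] >
   (1 - n%:R * (n%:R - 1) / 2 ^+ d)%:E)%E.
Proof.
set E := [set w | _].
have mE : measurable E.
  by apply: measurable_linearly_separable => i; exact: measurable_funPT.
pose bad (p : 'I_n * 'I_n) := [set w | diam_ball (X p.2 w) (X p.1 w)].
have mbad p : measurable (bad p).
  rewrite -[X in measurable X]setTI; apply: measurable_fun_le => //;
  by apply: measurable_dotp; exact: measurable_funPT.
(* Union bound: if the sample is not separable, some point lies in the diameter ball of another. *)
have PE : (P (~` E) <= \sum_(p | p.1 != p.2) P (bad p))%E.
  rewrite bigfs ?index_enum_uniq//; last by move=> p _; rewrite mem_index_enum.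
  apply: content_sub_fsum => //.
    exact: measurableC.
  move=> w; apply: contra_notP => h.
  apply: (linearly_separable_diam_ball (fun i => X i w)) => i j ij b.
  by apply: h; exists (i, j).
have Pbad p : p.1 != p.2 -> (P (bad p) < (2 ^- d)%:E)%E.
  move=> p12; apply: (prob_in_diam_ball _ _ _ hd hr0 hr1 (hunif _) (hunif _)).
  by apply: independent_RVs_pair => //; rewrite eq_sym.
have Pfin A : measurable A -> P A = (fine (P A))%:E.
  by move=> mA; rewrite fineK// fin_num_measure.
have lt : (\sum_(p : 'I_n * 'I_n | p.1 != p.2) P (bad p) <
    (n%:R * (n%:R - 1) / 2 ^+ d)%:E)%E.
  under eq_bigr do rewrite Pfin//.
  rewrite sumEFin lte_fin -sum_offdiag; apply: ltr_sum.
    (* A strict inequality between sums needs at least one term; [2 <= n] provides the pair of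
       indices [(0, 1)]. *)
    apply/hasP; exists (Ordinal (ltnW hn), Ordinal hn) => //; exact: mem_index_enum.
  by move=> p /Pbad; rewrite Pfin// lte_fin.
rewrite -(setCK E) probability_setC; last exact: measurableC.
have := le_lt_trans PE lt.
rewrite (Pfin (~` E)); last exact: measurableC.
by rewrite -EFinB !lte_fin => ?; rewrite ltrD2l ltrN2.
Qed.
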